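(* Consider the ball-on-frame system described in the context, and for a smooth scalar function $\Theta:\mathcal{S}\to\mathbb{R}$ the synchronization function $\Phi(s)=(\Theta(s)-\psi(s),\,s)$, $s\in\mathcal{S}$, with associated reduced dynamics $$\alpha(s)\ddot s+\beta(s)\dot s^2+\gamma(s)=0,$$ whose coefficients are given in the context. A point $s_e\in\mathcal{S}$ for which $\alpha(s_e)\ne0$ is an equilibrium point of the reduced dynamics if $\Theta(s_e)=0$. Moreover, it is a center if $\Theta'(s_e)/\alpha(s_e)>0$, and a saddle if $\Theta'(s_e)/\alpha(s_e)<0$.
   Context: A ball of mass $m>0$, effective radius $r_b>0$ and moment of inertia $J_b>0$ rolls without slipping, always in contact, on the boundary of an actuated planar frame with moment of inertia $J_f>0$ that rotates by an angle $\theta$ in a vertical plane; $g>0$ is the gravitational acceleration and $\vec g=(0,g)$. The position of the ball along the frame is described by an angle $\varphi$, and $\vec\sigma(\varphi)\in\mathbb{R}^2$ is the position of the ball's center in frame-fixed coordinates, assumed to trace a smooth regular curve. Let $\zeta=\zeta(\varphi)$ be the arc length of this curve (so $\zeta'>0$), $\vec\tau=(\cos\psi,\sin\psi)$ its unit tangent, where $\psi=\psi(\varphi)$ is the tangential angle, $\vec n=(-\sin\psi,\cos\psi)$ its unit normal, $\kappa=d\psi/d\zeta$ its signed curvature (so $\psi'=\kappa\zeta'$), and $\vec\kappa=\kappa\vec n$. All primes denote derivatives with respect to $\varphi$ (equivalently $s$ below). With $q=(\theta,\varphi)$ the equations of motion are $\mathbf{M}(q)\ddot q+\mathbf{C}(q,\dot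 q)\dot q+\mathbf{G}(q)=\mathbf{B}_uu$, $\mathbf{B}_u=(1,0)^{\mathsf T}$, where the second row of $\mathbf{M}$ is $\big[-(m\vec\sigma\cdot\vec n+\tfrac{J_b}{r_b})\zeta',\ (\tfrac{J_b}{r_b^2}+m)\zeta'^2\big]$, the second row of $\mathbf{C}$ is $\big[-m\zeta'(\vec\sigma\cdot\vec\tau)\dot\theta,\ (\tfrac{J_b}{r_b^2}+m)\zeta'\zeta''\dot\varphi\big]$, and the second component of $\mathbf{G}$ is $m\vec g\cdot(\mathrm{Rot}(\theta)\vec\tau\zeta')$, $\mathrm{Rot}(\theta)$ being the rotation matrix. The reduced dynamics associated with $\Phi(s)=(\Theta(s)-\psi(s),s)$ is obtained with the annihilator $\mathbf{B}_u^\perp=[0\ \ 1]$: $\alpha=\mathbf{B}_u^\perp\mathbf{M}(\Phi)\Phi'$, $\beta=\mathbf{B}_u^\perp[\mathbf{M}(\Phi)\Phi''+\mathbf{C}(\Phi,\Phi')\Phi']$, $\gamma=\mathbf{B}_u^\perp\mathbf{G}(\Phi)$. Explicitly, evaluating $\zeta,\psi,\kappa,\vec\sigma,\vec\tau,\vec n$ at $\varphi=s$, $$\gamma(s)=mg\,\zeta'\sin(\Theta(s)),$$ $$\alpha(s)=\Big(\tfrac{J_b}{r_b}\big(\kappa+\tfrac1{r_b}\big)+m(1+\vec\sigma\cdot\vec\kappa)\Big)\zeta'^2-\Big(m\vec\sigma\cdot\vec n+\tfrac{J_b}{r_b}\Big)\zeta'\Theta'(s),$$ $$\beta(s)=-\Big(m\vec\sigma\cdot\vec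 n+\tfrac{J_b}{r_b}\Big)\zeta'(\Theta''-\psi'')-m\zeta'(\vec\sigma\cdot\vec\tau)(\Theta'-\psi')^2+\Big(\tfrac{J_b}{r_b^2}+m\Big)\zeta'\zeta''.$$ Here $\mathcal{S}$ is an interval of the circle (or the circle), all functions being smooth in the sense of extending smoothly to a neighborhood of $\mathcal{S}$. An equilibrium point of the reduced dynamics is a point $s_e$ for which $s(t)\equiv s_e$ is a solution, i.e. $\gamma(s_e)=0$ with $\alpha(s_e)\neq0$. It is a center (resp. saddle) if $(s_e,0)$ is a center, i.e. surrounded in a neighborhood in the $(s,\dot s)$-plane by periodic orbits (resp. a hyperbolic saddle, i.e. the linearization there has one positive and one negative real eigenvalue). *)

(* Defs.v *)
From Stdlib Require Import Reals Lra.
From Coquelicot Require Import Coquelicot.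
Open Scope R_scope.

Definition dot (x y : R * R) : R := fst x * fst y + snd x * snd y.

Definition rot (a : R) (x : R * R) : R * R :=
  (cos a * fst x - sin a * snd x, sin a * fst x + cos a * snd x).

Definition smooth_on (U : R -> Prop) (f : R -> R) : Prop :=
  forall (n : nat) (x : R), U x -> ex_derive_n f n x.

(* Angles are lifted to the real line: the functions of phi below are functions
   on R, and only their values on an open set U of angles matter.
   [inertia_row1], [coriolis_row1] and [gravity_row1] are the parts of the
   equations of motion belonging to the actuated coordinate theta (the frame
   inertia J_f enters only there).  They are arbitrary, being annihilated by
   [0 1]. *)
Record ball_on_frame := BallOnFrame {
  mass : R;
  r_b : R;
  J_b : R;
  J_f : R;
  grav : R;
  sigma : R -> R * R;
  zeta : R -> R;
  psi : R -> R;
  inertia_row1 : R * R -> R * R;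
  coriolis_row1 : R * R -> R * R -> R * R;
  gravity_row1 : R * R -> R
}.

Section BallOnFrame.

Variable F : ball_on_frame.

Definition sigma' (phi : R) : R * R :=
  (Derive (fun x => fst (sigma F x)) phi, Derive (fun x => snd (sigma F x)) phi).

Definition tangent (phi : R) : R * R := (cos (psi F phi), sin (psi F phi)).

Definition normal (phi : R) : R * R := (- sin (psi F phi), cos (psi F phi)).

(* d psi / d zeta *)
Definition kappa (phi : R) : R := Derive (psi F) phi / Derive (zeta F) phi.

Definition kappa_vec (phi : R) : R * R :=
  (kappa phi * fst (normal phi), kappa phi * snd (normal phi)).

Definition gravity_vec : R * R := (0, grav F).

(* On U the curve sigma is smooth and regular, zeta is its arc length and psi
   its tangential angle, i.e. d sigma / d zeta = tangent. *)
Definition valid_frame (U : R -> Prop) : Prop :=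
  0 < mass F /\ 0 < r_b F /\ 0 < J_b F /\ 0 < J_f F /\ 0 < grav F /\
  smooth_on U (fun x => fst (sigma F x)) /\
  smooth_on U (fun x => snd (sigma F x)) /\
  smooth_on U (zeta F) /\
  smooth_on U (psi F) /\
  forall phi : R, U phi ->
    sigma' phi <> (0, 0) /\
    Derive (zeta F) phi = sqrt (dot (sigma' phi) (sigma' phi)) /\
    sigma' phi = (Derive (zeta F) phi * fst (tangent phi),
                  Derive (zeta F) phi * snd (tangent phi)).

(* The equations of motion are M(q) q'' + C(q, q') q' + G(q) = B_u u with
   q = (theta, phi); M, C, G are [inertia], [coriolis], [gravity]. *)

Definition inertia (q : R * R) : matrix 2 2 :=
  let phi := snd q in
  let zeta' := Derive (zeta F) phi in
  [ [ fst (inertia_row1 F q), snd (inertia_row1 F q) ],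
    [ - (mass F * dot (sigma F phi) (normal phi) + J_b F / r_b F) * zeta',
      (J_b F / r_b F ^ 2 + mass F) * zeta' ^ 2 ] ].

Definition coriolis (q dq : R * R) : matrix 2 2 :=
  let phi := snd q in
  let zeta' := Derive (zeta F) phi in
  let zeta'' := Derive_n (zeta F) 2 phi in
  [ [ fst (coriolis_row1 F q dq), snd (coriolis_row1 F q dq) ],
    [ - mass F * zeta' * dot (sigma F phi) (tangent phi) * fst dq,
      (J_b F / r_b F ^ 2 + mass F) * zeta' * zeta'' * snd dq ] ].

Definition gravity (q : R * R) : matrix 2 1 :=
  let phi := snd q in
  let zeta' := Derive (zeta F) phi in
  [ [ gravity_row1 F q ],
    [ mass F * dot gravity_vec
                 (rot (fst q) (fst (tangent phi) * zeta', snd (tangent phi) * zeta')) ] ].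

Definition B_u : matrix 2 1 := [ [ 1 ], [ 0 ] ].

Definition B_u_perp : matrix 1 2 := [ [ 0, 1 ] ].

Definition col (x : R * R) : matrix 2 1 := [ [ fst x ], [ snd x ] ].

Definition entry (A : matrix 1 1) : R := coeff_mat 0 A 0 0.

Variable Theta : R -> R.

Definition Phi (s : R) : R * R := (Theta s - psi F s, s).

Definition Phi' (s : R) : R * R :=
  (Derive (fun x => fst (Phi x)) s, Derive (fun x => snd (Phi x)) s).

Definition Phi'' (s : R) : R * R :=
  (Derive_n (fun x => fst (Phi x)) 2 s, Derive_n (fun x => snd (Phi x)) 2 s).

Definition alpha (s : R) : R :=
  entry (Mmult B_u_perp (Mmult (inertia (Phi s)) (col (Phi' s)))).

Definition beta (s : R) : R :=
  entry (Mmult B_u_perp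
           (Mplus (Mmult (inertia (Phi s)) (col (Phi'' s)))
                  (Mmult (coriolis (Phi s) (Phi' s)) (col (Phi' s))))).

Definition gamma (s : R) : R := entry (Mmult B_u_perp (gravity (Phi s))).

End BallOnFrame.

Lemma B_u_perp_annihilates : entry (Mmult B_u_perp B_u) = 0.
Proof.
  unfold entry, B_u_perp, B_u, Mmult, coeff_mat; simpl.
  rewrite sum_Sn, sum_O; unfold plus, mult, zero; simpl; ring.
Qed.

Lemma gamma_explicit (F : ball_on_frame) (Theta : R -> R) (s : R) :
  gamma F Theta s = mass F * grav F * Derive (zeta F) s * sin (Theta s).
Proof.
  replace (sin (Theta s)) with (sin ((Theta s - psi F s) + psi F s)) by (f_equal; ring).
  rewrite sin_plus.
  unfold gamma, entry, B_u_perp, gravity, Mmult, coeff_mat; simpl.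
  rewrite sum_Sn, sum_O; unfold plus, mult, zero, dot, gravity_vec, rot; simpl.
  ring.
Qed.

Lemma Derive_Phi1 (F : ball_on_frame) (Theta : R -> R) (U : R -> Prop) (s : R) :
  valid_frame F U -> smooth_on U Theta -> U s ->
  Phi' F Theta s = (Derive Theta s - Derive (psi F) s, 1).
Proof.
  intros (_ & _ & _ & _ & _ & _ & _ & _ & Hpsi & _) HT Us.
  unfold Phi', Phi; simpl; f_equal.
  - apply Derive_minus; [apply (HT 1%nat) | apply (Hpsi 1%nat)]; exact Us.
  - apply Derive_id.
Qed.

Lemma Derive_Phi2 (F : ball_on_frame) (Theta : R -> R) (U : R -> Prop) (s : R) :
  open U -> valid_frame F U -> smooth_on U Theta -> U s ->
  Phi'' F Theta s = (Derive_n Theta 2 s - Derive_n (psi F) 2 s, 0).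
Proof.
  intros HU (_ & _ & _ & _ & _ & _ & _ & _ & Hpsi & _) HT Us.
  unfold Phi'', Phi; cbn [fst snd]; f_equal.
  - apply Derive_n_minus; apply filter_imp with (2 := HU s Us);
      intros y Uy k _; [apply HT | apply Hpsi]; exact Uy.
  - simpl; rewrite (Derive_ext _ (fun _ => 1)).
    + apply Derive_const.
    + intros t; apply Derive_id.
Qed.

Lemma zeta'_pos (F : ball_on_frame) (U : R -> Prop) (s : R) :
  valid_frame F U -> U s -> 0 < Derive (zeta F) s.
Proof.
  intros (_ & _ & _ & _ & _ & _ & _ & _ & _ & H) Us.
  destruct (H s Us) as (Hreg & -> & _).
  apply sqrt_lt_R0.
  destruct (sigma' F s) as [a b]; unfold dot; simpl.
  destruct (Req_dec a 0) as [-> | Ha].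
  - destruct (Req_dec b 0) as [-> | Hb]; [now destruct Hreg |].
    generalize (Rsqr_pos_lt b Hb); unfold Rsqr; lra.
  - generalize (Rsqr_pos_lt a Ha) (Rle_0_sqr b); unfold Rsqr; lra.
Qed.

Lemma alpha_explicit (F : ball_on_frame) (Theta : R -> R) (U : R -> Prop) (s : R) :
  valid_frame F U -> smooth_on U Theta -> U s ->
  alpha F Theta s =
    (J_b F / r_b F * (kappa F s + 1 / r_b F)
       + mass F * (1 + dot (sigma F s) (kappa_vec F s))) * Derive (zeta F) s ^ 2
    - (mass F * dot (sigma F s) (normal F s) + J_b F / r_b F)
        * Derive (zeta F) s * Derive Theta s.
Proof.
  intros HF HT Us.
  generalize (zeta'_pos F U s HF Us); intros Hz.
  assert (Hr : 0 < r_b F) by apply HF.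
  unfold alpha; rewrite (Derive_Phi1 F Theta U s HF HT Us).
  unfold entry, B_u_perp, inertia, col, Mmult, coeff_mat; simpl.
  rewrite !sum_Sn, !sum_O; unfold plus, mult, zero; simpl.
  unfold kappa_vec, kappa, dot; simpl.
  field; split; lra.
Qed.

Lemma beta_explicit (F : ball_on_frame) (Theta : R -> R) (U : R -> Prop) (s : R) :
  open U -> valid_frame F U -> smooth_on U Theta -> U s ->
  beta F Theta s =
    - (mass F * dot (sigma F s) (normal F s) + J_b F / r_b F) * Derive (zeta F) s
        * (Derive_n Theta 2 s - Derive_n (psi F) 2 s)
    - mass F * Derive (zeta F) s * dot (sigma F s) (tangent F s)
        * (Derive Theta s - Derive (psi F) s) ^ 2
    + (J_b F / r_b F ^ 2 + mass F) * Derive (zeta F) s * Derive_n (zeta F) 2 s.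
Proof.
  intros HU HF HT Us.
  assert (Hr : 0 < r_b F) by apply HF.
  unfold beta; rewrite (Derive_Phi1 F Theta U s HF HT Us), (Derive_Phi2 F Theta U s HU HF HT Us).
  unfold entry, B_u_perp, inertia, coriolis, col, Mmult, Mplus, coeff_mat; simpl.
  rewrite !sum_Sn, !sum_O; unfold plus, mult, zero; simpl.
  field; lra.
Qed.

(* The domain S of Theta is lifted to R: either an arc, i.e. an interval of
   length at most 2 pi, or the whole circle, in which case Theta and the curve
   are 2 pi-periodic. *)
Definition circle_domain (F : ball_on_frame) (Theta : R -> R) (S : R -> Prop) : Prop :=
  ((forall x y z : R, S x -> S z -> x <= y <= z -> S y) /\
   (forall x y : R, S x -> S y -> Rabs (y - x) <= 2 * PI))
  \/
  ((forall x : R, S x) /\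
   (forall x : R, Theta (x + 2 * PI) = Theta x) /\
   (forall x : R, sigma F (x + 2 * PI) = sigma F x)).

(* Dynamics a(s) s'' + b(s) s'^2 + c(s) = 0 with state s in U. *)

Section ReducedDynamics.

Variables (U : R -> Prop) (a b c : R -> R).

Definition is_solution (s : R -> R) : Prop :=
  forall t : R,
    U (s t) /\ ex_derive s t /\ ex_derive_n s 2 t /\
    a (s t) * Derive_n s 2 t + b (s t) * Derive s t ^ 2 + c (s t) = 0.

Definition equilibrium (s_e : R) : Prop :=
  a s_e <> 0 /\ is_solution (fun _ => s_e).

Definition orbit (s : R -> R) (p : R * R) : Prop :=
  exists t : R, p = (s t, Derive s t).

(* p lies off K, in a bounded path component of the complement of K. *)
Definition encloses (K : R * R -> Prop) (p : R * R) : Prop :=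
  ~ K p /\
  exists r : R, forall w : R -> R * R,
    (forall t : R, continuous w t) -> w 0 = p ->
    (forall t : R, 0 <= t <= 1 -> ~ K (w t)) ->
    ball p r (w 1).

(* Through every point (s0, v0) close to, and other than, (s_e, 0) passes a
   periodic orbit surrounding (s_e, 0).  The orbits stay where a <> 0, so that
   they are orbits of the planar vector field below. *)
Definition center (s_e : R) : Prop :=
  locally ((s_e, 0) : R * R) (fun p : R * R =>
    p <> (s_e, 0) ->
    exists s : R -> R,
      is_solution s /\ (forall t : R, a (s t) <> 0) /\
      (s 0, Derive s 0) = p /\
      (exists T : R, 0 < T /\ forall t : R, s (t + T) = s t) /\
      encloses (orbit s) (s_e, 0)).

Definition planar_field (p : R * R) : R * R :=
  (snd p, - (b (fst p) * snd p ^ 2 + c (fst p)) / a (fst p)).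

Definition eigenvalue (L : R * R -> R * R) (l : R) : Prop :=
  exists x : R * R, x <> (0, 0) /\ L x = (l * fst x, l * snd x).

Definition saddle (s_e : R) : Prop :=
  exists L : R * R -> R * R,
    filterdiff planar_field (locally ((s_e, 0) : R * R)) L /\
    exists l1 l2 : R, l1 < 0 < l2 /\ eigenvalue L l1 /\ eigenvalue L l2.

End ReducedDynamics.

(* Main.v *)
(* The center is obtained without any existence theorem for differential
   equations.  Put p = beta / alpha, q = gamma / alpha, so that s'' + p s'^2 + q = 0,
   and nu = exp (int p).  The energy (nu s')^2 + z(s)^2 is conserved, where z^2 / 2 is
   a primitive of nu^2 q; as q vanishes at s_e with positive slope, z can be chosen
   C^1 with z' > 0.  On the level set of r^2 put nu s' = r cos th and
   z(s) = r sin th: then th' = z'(s) / nu(s) is a positive 2 pi-periodic function of th,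
   so th is the inverse of the time function int nu / z' dth, and s is periodic. *)

Require Import Defs.
From Stdlib Require Import Reals Lra ClassicalEpsilon.
From Coquelicot Require Import Coquelicot.
Open Scope R_scope.

(** The equation is controlled only near [s_e]: [alpha] may vanish elsewhere and [U] need not be the
    whole line. The angle argument, however, wants [nu] and [z] on all of R, with [z] onto R. The
    data are therefore extended from a small interval around [s_e], and only energy levels so low
    that the motion never leaves that interval are used. The extended force is merely continuous,
    and differentiable at the equilibrium, so a smooth Morse lemma does not apply and [z] is built
    by hand. C^1 is enough, because the motion involves [z] only through [z] and [z']. Taking an
    angle as the unknown makes the turning points [s' = 0] ordinary points: the time integral stays
    regular there. The angle runs through all of R, so an orbit is an entire energy level, and a
    path escaping from [(s_e, 0)] must cross it by the intermediate value theorem. The sign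
    condition enters through the slope of [gamma / alpha] at [s_e], which is
    [m g zeta' Theta' / alpha] with [m g zeta' > 0]. For a negative slope the linearization alone
    decides. *)

(** * Difference quotients and inverse functions on the whole line *)

Definition slope (f : R -> R) (l x y : R) : R :=
  if Req_EM_T y x then l else (f y - f x) / (y - x).

Lemma slope_diag f l x : slope f l x x = l.
Proof. unfold slope; destruct (Req_EM_T x x); easy. Qed.

Lemma slope_mult f l x y : f y = f x + slope f l x y * (y - x).
Proof.
  unfold slope; destruct (Req_EM_T y x) as [-> | H]; [ring |].
  field; lra.
Qed.

(** One direction of Carathéodory's criterion: differentiability at [x] is continuity of the
    completed difference quotient at [x]. *)
Lemma continuous_slope_diag f l x : is_derive f x l -> continuous (slope f l x) x.
Proof.
  intros H; apply is_derive_Reals in H.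
  apply filterlim_locally; intros eps.
  destruct (H eps (cond_pos eps)) as [d Hd].
  exists d; intros y Hy; rewrite slope_diag.
  unfold slope; destruct (Req_EM_T y x) as [-> | Hyx]; [apply ball_center |].
  change (Rabs (y - x) < d) in Hy.
  change (Rabs ((f y - f x) / (y - x) - l) < eps).
  specialize (Hd (y - x)); rewrite Rplus_minus in Hd.
  apply Hd; [now apply Rminus_eq_contra | exact Hy].
Qed.

(** The other direction of the criterion. It differentiates inverse functions, and also [z] at the
    equilibrium, from a factorization alone. *)
Lemma is_derive_of_slope (f phi : R -> R) x :
  continuous phi x -> (forall y, f y = f x + phi y * (y - x)) ->
  is_derive f x (phi x).
Proof.
  intros H Hf; apply is_derive_Reals; intros eps Heps.
  destruct (proj1 (filterlim_locally phi (phi x)) H (mkposreal eps Heps)) as [d Hd].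
  exists d; intros h Hh Hhd.
  replace ((f (x + h) - f x) / h) with (phi (x + h)).
  - assert (E : x + h - x = h) by ring.
    apply Hd; change (Rabs (x + h - x) < d); now rewrite E.
  - rewrite (Hf (x + h)); field; exact Hh.
Qed.

Lemma continuous_of_is_derive (f : R -> R) x l : is_derive f x l -> continuous f x.
Proof. intros H; apply (ex_derive_continuous f); now exists l. Qed.

Lemma increasing_of_is_derive (f df : R -> R) :
  (forall x, is_derive f x (df x)) -> (forall x, 0 < df x) ->
  forall x y, x < y -> f x < f y.
Proof.
  intros Hf Hdf x y Hxy.
  destruct (MVT_cor2 f df x y Hxy) as (c & Hc & _).
  - intros c _; apply is_derive_Reals, Hf.
  - assert (0 < df c * (y - x)) by (apply Rmult_lt_0_compat; [apply Hdf | lra]); lra.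
Qed.

(** Monotonicity gives injectivity and continuity of the inverse, the intermediate value theorem
    surjectivity. The difference quotient of [f] at [g y], evaluated along [g], never vanishes, so
    its reciprocal is a continuous factor for [g]. *)
Lemma global_inverse (f df : R -> R) :
  (forall x, is_derive f x (df x)) -> (forall x, 0 < df x) ->
  (forall y, exists x, f x <= y) -> (forall y, exists x, y <= f x) ->
  exists g : R -> R,
    (forall y, f (g y) = y) /\ (forall x, g (f x) = x) /\
    (forall y, is_derive g y (/ df (g y))).
Proof.
  intros Hf Hdf Hlo Hup.
  assert (Hinc := increasing_of_is_derive f df Hf Hdf).
  assert (Hinc' : forall x y, f x < f y -> x < y).
  { intros x y H; destruct (Rtotal_order x y) as [L | [-> | L]]; [easy | lra |].
    apply Hinc in L; lra. }
  assert (Hsurj : forall y, exists x, f x = y).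
  { intros y; destruct (Hlo y) as [u Hu], (Hup y) as [v Hv].
    destruct (IVT_gen_consistent f u v y) as [x [_ Hx]].
    - intros x; apply continuous_of_is_derive with (1 := Hf x).
    - unfold Rmin, Rmax; destruct (Rle_dec (f u) (f v)); lra.
    - now exists x. }
  set (g := fun y => proj1_sig (constructive_indefinite_description _ (Hsurj y))).
  assert (Hg : forall y, f (g y) = y).
  { intros y; unfold g; apply (proj2_sig (constructive_indefinite_description _ (Hsurj y))). }
  assert (Hg' : forall x, g (f x) = x).
  { intros x; destruct (Rtotal_order (g (f x)) x) as [L | [E | L]]; [| easy |];
      apply Hinc in L; rewrite Hg in L; lra. }
  assert (Hcont : forall y, continuous g y).
  { intros y; apply filterlim_locally; intros eps.
    assert (L1 : f (g y - eps) < y).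
    { rewrite <- (Hg y) at 2; apply Hinc; generalize (cond_pos eps); lra. }
    assert (L2 : y < f (g y + eps)).
    { rewrite <- (Hg y) at 1; apply Hinc; generalize (cond_pos eps); lra. }
    assert (Hd : 0 < Rmin (y - f (g y - eps)) (f (g y + eps) - y)).
    { apply Rmin_pos; lra. }
    exists (mkposreal _ Hd); intros w Hw.
    change (Rabs (w - y) < Rmin (y - f (g y - eps)) (f (g y + eps) - y)) in Hw.
    change (Rabs (g w - g y) < eps).
    generalize (Rmin_l (y - f (g y - eps)) (f (g y + eps) - y))
               (Rmin_r (y - f (g y - eps)) (f (g y + eps) - y)); intros M1 M2.
    apply Rabs_def2 in Hw.
    assert (g y - eps < g w) by (apply Hinc'; rewrite Hg; lra).
    assert (g w < g y + eps) by (apply Hinc'; rewrite Hg; lra).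
    apply Rabs_def1; lra. }
  exists g; split; [exact Hg | split; [exact Hg' |]].
  intros y.
  set (sl := fun w => slope f (df (g y)) (g y) (g w)).
  assert (Hsl : forall w, sl w <> 0).
  { intros w; unfold sl, slope; destruct (Req_EM_T (g w) (g y)) as [_ | Hne].
    - generalize (Hdf (g y)); lra.
    - unfold Rdiv; apply Rmult_integral_contrapositive; split.
      + destruct (Rtotal_order (g w) (g y)) as [L | [L | L]]; [apply Hinc in L | easy | apply Hinc in L]; lra.
      + apply Rinv_neq_0_compat; lra. }
  replace (/ df (g y)) with (/ sl y) by (unfold sl; now rewrite slope_diag).
  apply (is_derive_of_slope g (fun w => / sl w)).
  - apply continuous_Rinv_comp; [| apply Hsl].
    apply (continuous_comp g (slope f (df (g y)) (g y))); [apply Hcont |].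
    apply continuous_slope_diag, Hf.
  - intros w.
    assert (E := slope_mult f (df (g y)) (g y) (g w)); rewrite !Hg in E.
    fold (sl w) in E.
    replace (w - y) with (sl w * (g w - g y)) by lra; field; apply Hsl.
Qed.

(** * Primitives and the square root of a potential *)

Lemma is_derive_RInt_continuous (f : R -> R) (e : R) :
  (forall x, continuous f x) -> forall x, is_derive (fun y => RInt f e y) x (f x).
Proof.
  intros Hf x; apply (is_derive_RInt f (fun y => RInt f e y) e x); [| apply Hf].
  apply filter_forall; intros y; apply (RInt_correct (V := R_CompleteNormedModule)).
  apply (ex_RInt_continuous (V := R_CompleteNormedModule)).
  intros w _; apply Hf.
Qed.

(* Apply Rolle's theorem to W y * x^2 - W x * y^2 between 0 and x. *)
Lemma quadratic_mean_value (W G : R -> R) (x : R) :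
  (forall y, is_derive W y (G y)) -> W 0 = 0 -> x <> 0 ->
  exists c, Rabs c <= Rabs x /\ c <> 0 /\ 2 * W x / x ^ 2 = G c / c.
Proof.
  intros HW W0 Hx.
  set (f := fun y => W y * x ^ 2 - W x * y ^ 2).
  set (df := fun y => G y * x ^ 2 - W x * (2 * y)).
  assert (Hf : forall y, derivable_pt_lim f y (df y)).
  { intros y; apply is_derive_Reals; unfold f, df.
    assert (Ey : ex_derive W y) by (now exists (G y)).
    auto_derive; [exact Ey |].
    replace (Derive (fun x => W x) y) with (G y) by (symmetry; apply is_derive_unique, HW).
    ring. }
  assert (F0 : f 0 = 0) by (unfold f; rewrite W0; ring).
  assert (Fx : f x = 0) by (unfold f; ring).
  assert (Hc : exists c, df c = 0 /\ Rabs c <= Rabs x /\ c <> 0).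
  { destruct (Rtotal_order x 0) as [L | [E | L]]; [| easy |].
    - destruct (MVT_cor2 f df x 0 L (fun c _ => Hf c)) as (c & Ec & Lc).
      exists c; repeat split; [| rewrite !Rabs_left; lra | lra].
      rewrite F0, Fx in Ec; apply Rmult_eq_reg_r with (0 - x); lra.
    - destruct (MVT_cor2 f df 0 x L (fun c _ => Hf c)) as (c & Ec & Lc).
      exists c; repeat split; [| rewrite !Rabs_right; lra | lra].
      rewrite F0, Fx in Ec; apply Rmult_eq_reg_r with (x - 0); lra. }
  destruct Hc as (c & Ec & Lc & Nc); exists c; repeat split; [exact Lc | exact Nc |].
  unfold df in Ec; apply Rmult_eq_reg_r with (x ^ 2 * c).
  - field_simplify; [lra | easy | easy].
  - apply Rmult_integral_contrapositive; split; [apply pow_nonzero |]; easy.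
Qed.

(* One-dimensional Morse lemma: z = x sqrt (2 W x / x^2), where W' = G. *)
Lemma square_root_of_potential (G : R -> R) (k : R) :
  0 < k -> (forall x, continuous G x) -> G 0 = 0 -> is_derive G 0 k ->
  (forall x, k / 2 * x ^ 2 <= x * G x) ->
  exists z dz : R -> R,
    (forall x, is_derive z x (dz x)) /\ (forall x, continuous dz x) /\
    (forall x, 0 < dz x) /\ (forall x, z x * dz x = G x) /\
    z 0 = 0 /\ (forall x, k / 2 * x ^ 2 <= z x ^ 2).
Proof.
  intros Hk CG G0 DG BG.
  set (W := (fun x => RInt G 0 x) : R -> R).
  assert (HW : forall x, is_derive W x (G x)) by (apply is_derive_RInt_continuous, CG).
  assert (W0 : W 0 = 0) by apply (RInt_point (V := R_CompleteNormedModule)).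
  set (A := fun x => if Req_EM_T x 0 then k else 2 * W x / x ^ 2).
  set (B := fun x => if Req_EM_T x 0 then k else G x / x).
  assert (GB : forall x, G x = x * B x).
  { intros x; unfold B; destruct (Req_EM_T x 0) as [-> | Hx]; [rewrite G0; ring | now field]. }
  assert (WA : forall x, 2 * W x = x ^ 2 * A x).
  { intros x; unfold A; destruct (Req_EM_T x 0) as [-> | Hx]; [rewrite W0; ring | now field]. }
  (* This intermediate point carries both the lower bound [k / 2] and the continuity at 0 from [B]
     to [A]. *)
  assert (AB : forall x, exists c, Rabs c <= Rabs x /\ A x = B c).
  { intros x; unfold A; destruct (Req_EM_T x 0) as [-> | Hx].
    - exists 0; split; [lra |]; unfold B; now destruct (Req_EM_T 0 0).
    - destruct (quadratic_mean_value W G x HW W0 Hx) as (c & Lc & Nc & Ec).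
      exists c; split; [exact Lc |]; unfold B; now destruct (Req_EM_T c 0). }
  assert (Bpos : forall x, k / 2 <= B x).
  { intros x; destruct (Req_EM_T x 0) as [-> | Hx].
    - unfold B; destruct (Req_EM_T 0 0); lra.
    - apply Rmult_le_reg_r with (x ^ 2); [now apply pow2_gt_0 |].
      specialize (BG x); rewrite GB in BG; lra. }
  assert (Apos : forall x, k / 2 <= A x).
  { intros x; destruct (AB x) as (c & _ & ->); apply Bpos. }
  assert (Sq : forall x, 0 < sqrt (A x)).
  { intros x; apply sqrt_lt_R0; specialize (Apos x); lra. }
  assert (Away : forall x, x <> 0 -> locally x (fun y => y <> 0)).
  { intros x Hx; exists (mkposreal _ (Rabs_pos_lt x Hx)); intros y Hy ->.
    change (Rabs (0 - x) < Rabs x) in Hy.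
    rewrite Rminus_0_l, Rabs_Ropp in Hy; lra. }
  assert (CB : forall x, continuous B x).
  { intros x; destruct (Req_EM_T x 0) as [-> | Hx].
    - apply continuous_ext with (2 := continuous_slope_diag G k 0 DG).
      intros y; unfold slope, B; destruct (Req_EM_T y 0); [easy |].
      now rewrite G0, !Rminus_0_r.
    - apply continuous_ext_loc with (fun y => G y * / y).
      + generalize (Away x Hx); apply filter_imp; intros y Hy.
        unfold B; now destruct (Req_EM_T y 0).
      + apply (continuous_mult G Rinv); [apply CG | now apply continuous_Rinv]. }
  assert (CA : forall x, continuous A x).
  { intros x; destruct (Req_EM_T x 0) as [-> | Hx].
    - apply filterlim_locally; intros eps.
      destruct (proj1 (filterlim_locally B (B 0)) (CB 0) eps) as [d Hd].
      exists d; intros y Hy; destruct (AB y) as (c & Lc & ->).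
      replace (A 0) with (B 0) by (unfold A, B; now destruct (Req_EM_T 0 0)).
      apply Hd; change (Rabs (c - 0) < d); change (Rabs (y - 0) < d) in Hy.
      rewrite Rminus_0_r in *; now apply Rle_lt_trans with (2 := Hy).
    - apply continuous_ext_loc with (fun y => 2 * W y * / y ^ 2).
      + generalize (Away x Hx); apply filter_imp; intros y Hy.
        unfold A; now destruct (Req_EM_T y 0).
      + apply (ex_derive_continuous (fun y => 2 * W y * / y ^ 2)); auto_derive.
        repeat split; [now exists (G x) |]; rewrite Rmult_1_r.
        now apply Rmult_integral_contrapositive. }
  (* The derivative is dictated by [z z' = G = x B]. This form avoids differentiating [sqrt A], of
     which only continuity is known at 0. *)
  exists (fun x => x * sqrt (A x)), (fun x => B x / sqrt (A x)); refine (conj _ (conj _ (conj _ (conj _ (conj _ _))))).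
  - intros x; destruct (Req_EM_T x 0) as [-> | Hx].
    + replace (B 0 / sqrt (A 0)) with (sqrt (A 0)).
      * apply (is_derive_of_slope _ (fun x => sqrt (A x))); [| intros y; ring].
        apply continuous_sqrt_comp, CA.
      * specialize (Sq 0); apply Rmult_eq_reg_r with (sqrt (A 0)); [| lra].
        field_simplify; [| lra].
        rewrite <- Rsqr_pow2, Rsqr_sqrt; [| specialize (Apos 0); lra].
        unfold A, B; now destruct (Req_EM_T 0 0).
    + assert (E : A x = 2 * W x / x ^ 2) by (unfold A; now destruct (Req_EM_T x 0)).
      apply (is_derive_ext_loc (fun y => y * sqrt (2 * W y * / y ^ 2))).
      * generalize (Away x Hx); apply filter_imp; intros y Hy.
        unfold A; now destruct (Req_EM_T y 0).
      * assert (P := Apos x); specialize (Sq x).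
        assert (S2 : sqrt (A x) * sqrt (A x) = A x) by (apply sqrt_sqrt; lra).
        assert (EW : ex_derive W x) by (now exists (G x)).
        unfold Rdiv in E; simpl in E.
        auto_derive; replace (2 * W x * / (x * (x * 1))) with (A x).
        -- repeat split; [exact EW | | lra].
           rewrite Rmult_1_r; now apply Rmult_integral_contrapositive.
        -- replace (Derive (fun x => W x) x) with (x * B x)
             by (symmetry; rewrite <- GB; apply is_derive_unique, HW).
           replace (W x) with (x ^ 2 * A x / 2) by (rewrite <- WA; field).
           set (q := sqrt (A x)) in *; rewrite <- S2; field; split; [lra | exact Hx].
  - intros x; apply (continuous_mult B (fun y => / sqrt (A y))); [apply CB |].
    apply continuous_Rinv_comp; [apply continuous_sqrt_comp, CA |].
    specialize (Sq x); lra.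
  - intros x; apply Rdiv_lt_0_compat; [specialize (Bpos x); lra | apply Sq].
  - intros x; rewrite GB; specialize (Sq x); field; lra.
  - ring.
  - intros x; rewrite Rpow_mult_distr, <- (Rsqr_pow2 (sqrt _)), Rsqr_sqrt;
      [| specialize (Apos x); lra].
    rewrite Rmult_comm; apply Rmult_le_compat_l; [apply pow2_ge_0 | apply Apos].
Qed.

(** * Periodic motion on an energy level *)

Lemma is_derive_comp_R (f g : R -> R) (x df dg : R) :
  is_derive f (g x) df -> is_derive g x dg ->
  is_derive (fun y => f (g y)) x (df * dg).
Proof.
  intros Hf Hg; rewrite Rmult_comm.
  exact (is_derive_comp f g x df dg Hf Hg).
Qed.

(** Separation of variables for [th' = 1 / h(th)]: [T] is the primitive of [h]. As [h] is periodic,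
    [T] gains the same amount [P], the integral of [h] over one period, on every turn. Hence [T] is
    unbounded both ways and has a global inverse. *)
Lemma periodic_phase (h : R -> R) :
  (forall x, continuous h x) -> (forall x, 0 < h x) ->
  (forall x, h (x + 2 * PI) = h x) ->
  exists (P : R) (T th : R -> R),
    0 < P /\ (forall x, th (T x) = x) /\
    (forall t, is_derive th t (/ h (th t))) /\
    (forall t, th (t + P) = th t + 2 * PI).
Proof.
  intros Hc Hpos Hper.
  set (T := (fun x => RInt h 0 x) : R -> R).
  assert (HT : forall x, is_derive T x (h x)) by (apply is_derive_RInt_continuous, Hc).
  assert (T0 : T 0 = 0) by apply (RInt_point (V := R_CompleteNormedModule)).
  assert (Tinc := increasing_of_is_derive T h HT Hpos).
  assert (Pi := PI_RGT_0).
  set (P := T (2 * PI)).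
  assert (HP : 0 < P) by (rewrite <- T0; apply Tinc; lra).
  assert (Tper : forall x, T (x + 2 * PI) = T x + P).
  { set (D := fun x => T (x + 2 * PI) - T x).
    assert (HD : forall x, is_derive D x 0).
    { intros x; unfold D.
      replace 0 with (h (x + 2 * PI) * 1 - h x) by (rewrite Hper; ring).
      apply (is_derive_minus (fun x => T (x + 2 * PI)) T); [| apply HT].
      apply (is_derive_comp_R T (fun x => x + 2 * PI)); [apply HT |].
      auto_derive; [easy | ring]. }
    assert (HD0 : D 0 = P) by (unfold D; rewrite T0, Rplus_0_l; unfold P; ring).
    intros x; assert (E : D x = P).
    { destruct (Rtotal_order x 0) as [L | [-> | L]]; [| exact HD0 |]; rewrite <- HD0.
      - apply (eq_is_derive (V := R_NormedModule)); [| exact L]; intros t _; apply HD.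
      - symmetry; apply (eq_is_derive (V := R_NormedModule)); [| exact L]; intros t _; apply HD. }
    unfold D in E; lra. }
  assert (Tmult : forall n, T (INR n * (2 * PI)) = INR n * P /\ T (- (INR n * (2 * PI))) = - (INR n * P)).
  { induction n as [| n [I1 I2]].
    - simpl; rewrite !Rmult_0_l, Ropp_0, T0; lra.
    - rewrite S_INR; split.
      + replace ((INR n + 1) * (2 * PI)) with (INR n * (2 * PI) + 2 * PI) by ring.
        rewrite Tper, I1; ring.
      + generalize (Tper (- ((INR n + 1) * (2 * PI)))).
        replace (- ((INR n + 1) * (2 * PI)) + 2 * PI) with (- (INR n * (2 * PI))) by ring.
        rewrite I2; lra. }
  destruct (global_inverse T h HT Hpos) as (th & Hth1 & Hth2 & Hth3).
  - intros y; destruct (INR_archimed P (- y) HP) as [n Hn].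
    exists (- (INR n * (2 * PI))); rewrite (proj2 (Tmult n)); lra.
  - intros y; destruct (INR_archimed P y HP) as [n Hn].
    exists (INR n * (2 * PI)); rewrite (proj1 (Tmult n)); lra.
  - exists P, T, th; refine (conj HP (conj Hth2 (conj Hth3 _))).
    intros t; rewrite <- (Hth2 (th t + 2 * PI)), Tper, Hth1; reflexivity.
Qed.

(* The motion on the level set nu(s)^2 s'^2 + z(s)^2 = r^2, parametrized by the
   angle th with nu(s) s' = r cos th, z(s) = r sin th, for which th' = z'(s) / nu(s). *)
Lemma level_set_motion (nu z dz : R -> R) (r th0 : R) :
  (forall x, continuous nu x) -> (forall x, 0 < nu x) ->
  (forall x, is_derive z x (dz x)) -> (forall x, continuous dz x) ->
  (forall x, 0 < dz x) ->
  (forall y, exists x, z x <= y) -> (forall y, exists x, y <= z x) ->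
  exists (P : R) (s th : R -> R),
    0 < P /\ th 0 = th0 /\ (forall x, exists t, th t = x) /\
    (forall t, s (t + P) = s t) /\
    (forall t, z (s t) = r * sin (th t)) /\
    (forall t, is_derive s t (r * cos (th t) / nu (s t))) /\
    (forall t, is_derive th t (dz (s t) / nu (s t))).
Proof.
  intros Cnu Pnu Hz Cdz Pdz Lo Up.
  destruct (global_inverse z dz Hz Pdz Lo Up) as (g & Hg1 & Hg2 & Hg3).
  (* [x u] is the position at angle [u], and [h u] is dt/du there. Both see [u] only through
     [sin u], whence the period [2 * PI]. *)
  set (x := fun u => g (r * sin u)).
  set (h := fun u => nu (x u) * / dz (x u)).
  assert (Cx : forall u, continuous x u).
  { intros u; apply (continuous_comp (fun u => r * sin u) g).
    - apply (ex_derive_continuous (fun u => r * sin u)); now auto_derive.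
    - apply continuous_of_is_derive with (1 := Hg3 _). }
  destruct (periodic_phase h) as (P & T & ph & HP & Hph1 & Hph2 & Hph3).
  - intros u; apply (continuous_mult (fun u => nu (x u)) (fun u => / dz (x u))).
    + apply (continuous_comp x nu); [apply Cx | apply Cnu].
    + apply continuous_Rinv_comp; [| specialize (Pdz (x u)); lra].
      apply (continuous_comp x dz); [apply Cx | apply Cdz].
  - intros u; apply Rmult_lt_0_compat; [apply Pnu | apply Rinv_0_lt_compat, Pdz].
  - intros u; unfold h, x; now rewrite sin_plus, cos_2PI, sin_2PI, Rmult_1_r, Rmult_0_r, Rplus_0_r.
  - set (th := fun t => ph (t + T th0)).
    assert (Hth : forall t, is_derive th t (dz (x (th t)) / nu (x (th t)))).
    { intros t; replace (dz (x (th t)) / nu (x (th t))) with (/ h (th t) * 1).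
      - apply (is_derive_comp_R ph (fun t => t + T th0)); [apply Hph2 |].
        auto_derive; [easy | ring].
      - unfold h; specialize (Pnu (x (th t))); specialize (Pdz (x (th t))); field; lra. }
    exists P, (fun t => x (th t)), th.
    refine (conj HP (conj _ (conj _ (conj _ (conj _ (conj _ Hth)))))).
    + unfold th; now rewrite Rplus_0_l.
    + intros u; exists (T u - T th0); unfold th.
      now replace (T u - T th0 + T th0) with (T u) by ring.
    + intros t; unfold x, th; replace (t + P + T th0) with (t + T th0 + P) by ring.
      now rewrite Hph3, sin_plus, cos_2PI, sin_2PI, Rmult_1_r, Rmult_0_r, Rplus_0_r.
    + intros t; apply Hg1.
    + intros t.
      replace (r * cos (th t) / nu (x (th t))) with
        (/ dz (x (th t)) * (r * cos (th t) * (dz (x (th t)) / nu (x (th t))))).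
      * apply (is_derive_comp_R g (fun t => r * sin (th t))); [apply Hg3 |].
        apply (is_derive_comp_R (fun u => r * sin u) th); [| apply Hth].
        auto_derive; [easy | ring].
      * specialize (Pnu (x (th t))); specialize (Pdz (x (th t))); field; lra.
Qed.

(** [acos (x / r)] fixes the angle up to sign, and the sign of [y] decides. *)
Lemma polar_coordinates (x y r : R) :
  0 < r -> x ^ 2 + y ^ 2 = r ^ 2 -> exists u, x = r * cos u /\ y = r * sin u.
Proof.
  intros Hr E.
  assert (E1 : (x / r) ^ 2 + (y / r) ^ 2 = 1).
  { rewrite !Rdiv_def, !Rpow_mult_distr, <- Rmult_plus_distr_r, E; field; lra. }
  assert (Hx : -1 <= x / r <= 1).
  { generalize (pow2_ge_0 (y / r)); nra. }
  assert (C := cos_acos _ Hx).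
  assert (S := sin_acos _ Hx).
  assert (S2 : 1 - (x / r)² = (y / r)²) by (rewrite !Rsqr_pow2; lra).
  rewrite S2, sqrt_Rsqr_abs in S.
  destruct (Rle_dec 0 (y / r)) as [L | L].
  - exists (acos (x / r)); rewrite C, S, Rabs_right by lra; split; field; lra.
  - exists (- acos (x / r)); rewrite cos_neg, sin_neg, C, S, Rabs_left by lra; split; field; lra.
Qed.

(** * Extending the local data to the whole line *)

(** For [0 <= d], the projection onto [[-d, d]], in a closed form whose continuity needs no case
    distinction. *)
Definition clamp (d x : R) : R := (Rabs (x + d) - Rabs (x - d)) / 2.

Lemma continuous_clamp d x : continuous (clamp d) x.
Proof.
  unfold clamp, Rdiv.
  apply (continuous_mult (fun y => Rabs (y + d) - Rabs (y - d)) (fun _ => / 2));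
    [| apply continuous_const].
  apply (continuous_minus (fun y => Rabs (y + d)) (fun y => Rabs (y - d)));
    apply continuous_Rabs_comp.
  - apply (ex_derive_continuous (fun y => y + d)); now auto_derive.
  - apply (ex_derive_continuous (fun y => y - d)); now auto_derive.
Qed.

Lemma clamp_id d x : Rabs x <= d -> clamp d x = x.
Proof. unfold clamp; intros H; split_Rabs; lra. Qed.

Lemma Rabs_clamp d x : 0 <= d -> Rabs (clamp d x) <= d /\ Rabs (clamp d x) <= Rabs x.
Proof.
  unfold clamp; intros H; unfold Rabs.
  destruct (Rcase_abs (x + d)), (Rcase_abs (x - d)), (Rcase_abs x);
    match goal with |- context [Rcase_abs ?u] => destruct (Rcase_abs u) end; lra.
Qed.

(** The tolerance is half the slope, so that [y * f y] stays above [k / 2 * y ^ 2] near 0. *)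
Lemma linear_bound_of_is_derive (f : R -> R) (k : R) :
  0 < k -> f 0 = 0 -> is_derive f 0 k ->
  exists d, 0 < d /\ forall y, Rabs y < d -> Rabs (f y - k * y) <= k / 2 * Rabs y.
Proof.
  intros Hk f0 Hf; apply is_derive_Reals in Hf.
  assert (Hk2 : 0 < k / 2) by lra.
  destruct (Hf _ Hk2) as [d Hd]; exists d; split; [apply cond_pos |].
  intros y Hy; destruct (Req_EM_T y 0) as [-> | Hy0].
  - rewrite f0, Rmult_0_r, Rminus_0_r, Rabs_R0; lra.
  - specialize (Hd y Hy0 Hy); rewrite Rplus_0_l, f0, Rminus_0_r in Hd.
    replace (f y - k * y) with ((f y / y - k) * y) by (now field).
    rewrite Rabs_mult; apply Rmult_le_compat_r; [apply Rabs_pos | lra].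
Qed.

(* nu is the integrating factor exp (int p), z^2 / 2 the potential of nu^2 q;
   clamping their arguments makes both global without changing them near e. *)
Lemma integrating_data (p q : R -> R) (e k d0 : R) :
  0 < d0 -> 0 < k ->
  (forall x, Rabs (x - e) < d0 -> continuous p x) ->
  (forall x, Rabs (x - e) < d0 -> continuous q x) ->
  q e = 0 -> is_derive q e k ->
  exists (nu z dz : R -> R) (d : R),
    0 < d <= d0 /\
    (forall x, continuous nu x) /\ (forall x, 0 < nu x) /\
    (forall x, is_derive z x (dz x)) /\ (forall x, continuous dz x) /\
    (forall x, 0 < dz x) /\
    z e = 0 /\ (forall x, k / 2 * (x - e) ^ 2 <= z x ^ 2) /\
    (forall x, Rabs (x - e) < d -> is_derive nu x (nu x * p x)) /\
    (forall x, Rabs (x - e) < d -> z x * dz x = nu x ^ 2 * q x).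
Proof.
  intros Hd0 Hk Cp Cq q0 Dq.
  (* Clamping has a closed range, so halving [d0] keeps it inside the open interval where [p] is
     continuous. *)
  set (d1 := d0 / 2).
  assert (Hd1 : 0 < d1 < d0) by (unfold d1; lra).
  set (pc := fun x => p (e + clamp d1 (x - e))).
  set (nu := fun x => exp (RInt pc e x)).
  assert (Csh : forall x, continuous (fun x => e + clamp d1 (x - e)) x).
  { intros x; apply (continuous_plus (fun _ => e) (fun x => clamp d1 (x - e)));
      [apply continuous_const |].
    apply (continuous_comp (fun x => x - e) (clamp d1)); [| apply continuous_clamp].
    apply (ex_derive_continuous (fun y => y - e)); now auto_derive. }
  assert (Cpc : forall x, continuous pc x).
  { intros x; apply (continuous_comp (fun x => e + clamp d1 (x - e)) p); [apply Csh |].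
    apply Cp; rewrite Rplus_comm; unfold Rminus; rewrite Rplus_assoc, Rplus_opp_r, Rplus_0_r.
    generalize (Rabs_clamp d1 (x + - e)); lra. }
  assert (Dnu : forall x, is_derive nu x (nu x * pc x)).
  { intros x; apply (is_derive_comp_R exp (fun x => RInt pc e x)).
    - apply is_derive_exp.
    - now apply is_derive_RInt_continuous. }
  assert (Cnu : forall x, continuous nu x).
  { intros x; apply continuous_of_is_derive with (1 := Dnu x). }
  assert (nue : nu e = 1).
  { unfold nu; replace (RInt pc e e) with 0; [apply exp_0 |].
    symmetry; apply (RInt_point (V := R_CompleteNormedModule)). }
  (* The force [nu^2 q] with the equilibrium moved to 0. Since [nu e = 1] and [q e = 0], its slope
     at 0 is still [k]. *)
  set (G0 := fun y => nu (e + y) ^ 2 * q (e + y)).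
  assert (G00 : G0 0 = 0) by (unfold G0; rewrite Rplus_0_r, q0; ring).
  assert (DG0 : is_derive G0 0 k).
  { replace k with (k * 1) by ring.
    apply (is_derive_comp_R (fun x => nu x ^ 2 * q x) (fun y => e + y));
      [| auto_derive; [easy | ring]].
    rewrite Rplus_0_r.
    assert (E1 : ex_derive nu e) by (now exists (nu e * pc e)).
    assert (E2 : ex_derive q e) by (now exists k).
    auto_derive; [now split |].
    replace (Derive (fun x => q x) e) with k by (symmetry; now apply is_derive_unique).
    rewrite q0, nue; ring. }
  destruct (linear_bound_of_is_derive G0 k Hk G00 DG0) as (d2 & Hd2 & BG0).
  (* At most [d1], so that [pc] agrees with [p] there, and strictly below [d2], so that the closed
     range of [clamp d] lies where the linear bound holds. *)
  set (d := Rmin d1 (d2 / 2)).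
  assert (Hd : 0 < d /\ d <= d1 /\ d < d2).
  { unfold d; repeat split; [apply Rmin_pos; lra | apply Rmin_l |].
    apply Rle_lt_trans with (1 := Rmin_r _ _); lra. }
  (* Outside [[-d, d]] the force is continued with slope [k]. Then [G y - k y] is the value of
     [G0 - k] times the identity at [clamp d y], and the linear bound becomes global because
     clamping does not increase absolute values. *)
  set (G := fun y => G0 (clamp d y) + k * (y - clamp d y)).
  assert (Gloc : forall y, Rabs y < d -> G y = G0 y).
  { intros y Hy; unfold G; rewrite clamp_id by lra; ring. }
  assert (BG : forall y, Rabs (G y - k * y) <= k / 2 * Rabs y).
  { intros y; unfold G.
    replace (G0 (clamp d y) + k * (y - clamp d y) - k * y)
      with (G0 (clamp d y) - k * clamp d y) by ring.
    assert (B := Rabs_clamp d y); apply Rle_trans with (k / 2 * Rabs (clamp d y)).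
    - apply BG0; lra.
    - apply Rmult_le_compat_l; lra. }
  assert (CG0 : forall y, Rabs y < d0 -> continuous G0 y).
  { intros y Hy.
    assert (Ca : continuous (fun y => e + y) y).
    { apply (ex_derive_continuous (fun y => e + y)); now auto_derive. }
    apply (continuous_mult (fun y => nu (e + y) ^ 2) (fun y => q (e + y))).
    - apply (continuous_comp (fun y => e + y) (fun x => nu x ^ 2)); [exact Ca |].
      apply (ex_derive_continuous (fun x => nu x ^ 2)); auto_derive.
      now exists (nu (e + y) * pc (e + y)).
    - apply (continuous_comp (fun y => e + y) q); [exact Ca |].
      apply Cq; now replace (e + y - e) with y by ring. }
  assert (CG : forall y, continuous G y).
  { intros y; apply (continuous_plus (fun y => G0 (clamp d y)) (fun y => k * (y - clamp d y))).
    - apply (continuous_comp (clamp d) G0); [apply continuous_clamp |].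
      apply CG0; generalize (Rabs_clamp d y); lra.
    - apply (continuous_mult (fun _ => k) (fun y => y - clamp d y)); [apply continuous_const |].
      apply (continuous_minus (fun y => y) (clamp d)); [apply continuous_id | apply continuous_clamp]. }
  destruct (square_root_of_potential G k) as (z & dz & Hz & Cdz & Pdz & Ez & z0 & Bz).
  - exact Hk.
  - exact CG.
  - now rewrite Gloc, G00 by (rewrite Rabs_R0; lra).
  - apply (is_derive_ext_loc G0); [| exact DG0].
    exists (mkposreal d (proj1 Hd)); intros y Hy.
    change (Rabs (y - 0) < d) in Hy; rewrite Rminus_0_r in Hy; symmetry; now apply Gloc.
  - intros y; specialize (BG y).
    assert (B : Rabs (y * (G y - k * y)) <= k / 2 * y ^ 2).
    { rewrite Rabs_mult, <- Rsqr_pow2, Rsqr_abs; unfold Rsqr.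
      rewrite (Rmult_comm (Rabs y)).
      replace (k / 2 * (Rabs y * Rabs y)) with (k / 2 * Rabs y * Rabs y) by ring.
      apply Rmult_le_compat_r; [apply Rabs_pos | exact BG]. }
    apply Rabs_le_between in B; lra.
  - exists nu, (fun x => z (x - e)), (fun x => dz (x - e)), d.
    assert (Cs : forall x, continuous (fun x => x - e) x).
    { intros x; apply (ex_derive_continuous (fun y => y - e)); now auto_derive. }
    refine (conj _ (conj Cnu (conj _ (conj _ (conj _ (conj _ (conj _ (conj _ (conj _ _))))))))).
    + lra.
    + intros x; apply exp_pos.
    + intros x; rewrite <- (Rmult_1_r (dz (x - e))).
      apply (is_derive_comp_R z (fun x => x - e)); [apply Hz |].
      auto_derive; [easy | ring].
    + intros x; apply (continuous_comp (fun x => x - e) dz); [apply Cs | apply Cdz].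
    + intros x; apply Pdz.
    + now rewrite Rminus_diag.
    + intros x; apply Bz.
    + intros x Hx.
      replace (p x) with (pc x); [apply Dnu |].
      unfold pc; rewrite clamp_id by lra; f_equal; ring.
    + intros x Hx; rewrite Ez, Gloc by exact Hx.
      unfold G0; now replace (e + (x - e)) with x by ring.
Qed.

(** * Centers and saddles from the slope of [c / a] *)

Lemma center_of_positive_slope (U : R -> Prop) (a b c : R -> R) (e k : R) :
  locally e (fun x => U x /\ a x <> 0 /\
                      continuous (fun x => b x / a x) x /\
                      continuous (fun x => c x / a x) x) ->
  c e = 0 -> is_derive (fun x => c x / a x) e k -> 0 < k ->
  center U a b c e.
Proof.
  intros [d0 Hloc] ce Dq Hk.
  set (p := fun x => b x / a x) in *; set (q := fun x => c x / a x) in *.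
  destruct (integrating_data p q e k d0) as
    (nu & z & dz & d & Hd & Cnu & Pnu & Hz & Cdz & Pdz & ze & Bz & Dnu & Ez).
  1: apply cond_pos.
  1: exact Hk.
  1, 2: intros x Hx; apply (Hloc x Hx).
  1: unfold q; rewrite ce; apply Rmult_0_l.
  1: exact Dq.
  assert (zinc := increasing_of_is_derive z dz Hz Pdz).
  assert (zinj : forall x y, z x = z y -> x = y).
  { intros x y E; destruct (Rtotal_order x y) as [L | [L | L]];
      [apply zinc in L; lra | exact L | apply zinc in L; lra]. }
  (* With [w = 2 / k] the requirement is [w * M ^ 2 <= u ^ 2], and [(1 + w) ^ 2 >= w] makes the
     witness large enough without a square root. Together with the lower bound on [z ^ 2] this makes
     [z] unbounded on both sides. *)
  assert (Hm : forall M, exists u, 0 < u /\ M ^ 2 <= k / 2 * u ^ 2).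
  { intros M; exists (Rabs M * (1 + 2 / k) + 1).
    assert (H2 : 0 < 2 / k) by (apply Rdiv_lt_0_compat; lra).
    assert (HM := Rabs_pos M); split; [nra |].
    replace (M ^ 2) with (Rabs M ^ 2) by (apply pow2_abs).
    set (m := Rabs M) in *; set (w := 2 / k) in *.
    assert (kw : k = 2 / w) by (unfold w; field; lra).
    apply Rmult_le_reg_l with w; [exact H2 |].
    replace (w * (k / 2 * (m * (1 + w) + 1) ^ 2)) with ((m * (1 + w) + 1) ^ 2)
      by (rewrite kw; field; lra).
    nra. }
  assert (Up : forall y, exists x, y <= z x).
  { intros y; destruct (Hm y) as (u & Hu & Bu); exists (e + u).
    specialize (Bz (e + u)); replace (e + u - e) with u in Bz by ring.
    assert (z e < z (e + u)) by (apply zinc; lra).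
    rewrite ze in *; nra. }
  assert (Lo : forall y, exists x, z x <= y).
  { intros y; destruct (Hm y) as (u & Hu & Bu); exists (e - u).
    specialize (Bz (e - u)); replace ((e - u - e) ^ 2) with (u ^ 2) in Bz by ring.
    assert (z (e - u) < z e) by (apply zinc; lra).
    rewrite ze in *; nra. }
  set (E := fun x : R * R => (nu (fst x) * snd x) ^ 2 + z (fst x) ^ 2).
  assert (Cfst : forall x : R * R, continuous (fun x : R * R => fst x) x).
  { intros [x v]; apply (continuous_fst x v). }
  assert (Csnd : forall x : R * R, continuous (fun x : R * R => snd x) x).
  { intros [x v]; apply (continuous_snd x v). }
  assert (Csq : forall (f : R * R -> R) x, continuous f x -> continuous (fun x => f x ^ 2) x).
  { intros f x Cf; apply (continuous_comp f (fun y => y ^ 2)); [exact Cf |].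
    apply (ex_derive_continuous (fun y => y ^ 2)); now auto_derive. }
  assert (CE : forall x, continuous E x).
  { intros x.
    apply (continuous_plus (fun x : R * R => (nu (fst x) * snd x) ^ 2) (fun x => z (fst x) ^ 2)).
    - apply (Csq (fun x => nu (fst x) * snd x)).
      apply (continuous_mult (fun x : R * R => nu (fst x)) (fun x => snd x)); [| apply Csnd].
      apply (continuous_comp (fun x : R * R => fst x) nu); [apply Cfst | apply Cnu].
    - apply (Csq (fun x => z (fst x))).
      apply (continuous_comp (fun x : R * R => fst x) z); [apply Cfst |].
      apply continuous_of_is_derive with (1 := Hz _). }
  assert (Ee : E (e, 0) = 0) by (unfold E; simpl; rewrite ze; ring).
  (* Energies below [k / 2 * d ^ 2] confine the position to the interval on which [nu] and [z] obey
     the identities with [p] and [q]. *)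
  assert (close : forall x r, z x ^ 2 <= r -> r < k / 2 * d ^ 2 -> Rabs (x - e) < d).
  { intros x r H1 H2; specialize (Bz x).
    rewrite <- (Rabs_pos_eq d) by lra; apply Rsqr_lt_abs_0.
    rewrite !Rsqr_pow2; apply Rmult_lt_reg_l with (k / 2); lra. }
  assert (Hr0 : 0 < k / 2 * d ^ 2).
  { apply Rmult_lt_0_compat; [lra | apply pow_lt; lra]. }
  unfold center; generalize (proj1 (filterlim_locally E (E (e, 0))) (CE (e, 0)) (mkposreal _ Hr0)).
  apply filter_imp; intros [s0 v0]; change R in s0, v0; intros Hball Hne.
  rewrite Ee in Hball; change (Rabs (E (s0, v0) - 0) < k / 2 * d ^ 2) in Hball.
  apply Rabs_def2 in Hball; rewrite Rminus_0_r in Hball.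
  assert (Epos : 0 < E (s0, v0)).
  { assert (H1 := pow2_ge_0 (nu s0 * v0)); assert (H2 := pow2_ge_0 (z s0)).
    destruct (Req_EM_T (E (s0, v0)) 0) as [E0 | E0]; unfold E in *; simpl fst in *; simpl snd in *; [| lra].
    exfalso; apply Hne; f_equal.
    - apply zinj; rewrite ze.
      destruct (Req_EM_T (z s0) 0) as [E1 | E1]; [exact E1 |].
      generalize (pow2_gt_0 _ E1); lra.
    - destruct (Req_EM_T v0 0) as [E1 | E1]; [exact E1 |].
      assert (N : nu s0 * v0 <> 0).
      { apply Rmult_integral_contrapositive; split; [specialize (Pnu s0); lra | exact E1]. }
      generalize (pow2_gt_0 _ N); lra. }
  set (r := sqrt (E (s0, v0))).
  assert (Hr : 0 < r) by (now apply sqrt_lt_R0).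
  assert (r2 : r ^ 2 = E (s0, v0)).
  { unfold r; rewrite <- Rsqr_pow2; apply Rsqr_sqrt; lra. }
  destruct (polar_coordinates (nu s0 * v0) (z s0) r Hr) as (th0 & Hth1 & Hth2); [now rewrite r2 |].
  destruct (level_set_motion nu z dz r th0 Cnu Pnu Hz Cdz Pdz Lo Up)
    as (P & s & th & HP & th0E & thsurj & sper & zs & Ds & Dth).
  assert (s0E : s 0 = s0) by (apply zinj; now rewrite zs, th0E).
  assert (Ds' : forall t, Derive s t = r * cos (th t) / nu (s t)).
  { intros t; apply is_derive_unique, Ds. }
  assert (scirc : forall t, (r * cos (th t)) ^ 2 + (r * sin (th t)) ^ 2 = r ^ 2).
  { intros t; generalize (sin2_cos2 (th t)); rewrite !Rsqr_pow2; intros H.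
    rewrite !Rpow_mult_distr, <- Rmult_plus_distr_l, Rplus_comm; rewrite Rplus_comm in H.
    rewrite Rplus_comm, H; ring. }
  assert (near : forall t, Rabs (s t - e) < d).
  { intros t; apply close with (r ^ 2); [| lra].
    rewrite zs; generalize (scirc t) (pow2_ge_0 (r * cos (th t))); lra. }
  assert (good : forall t, U (s t) /\ a (s t) <> 0).
  { intros t; destruct (Hloc (s t)) as (H1 & H2 & _).
    - change (Rabs (s t - e) < d0); specialize (near t); lra.
    - now split. }
  (* In the derivative of [r cos th / nu], the factor [th'] produces [- q] through [z z' = nu^2 q],
     and [nu' = nu p] produces [- p s'^2]. *)
  assert (Dds : forall t, is_derive (Derive s) t (- (p (s t) * Derive s t ^ 2 + q (s t)))).
  { intros t.
    apply (is_derive_ext (fun t => r * cos (th t) / nu (s t))).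
    { intros u; symmetry; apply Ds'. }
    assert (X1 : ex_derive th t) by (now exists (dz (s t) / nu (s t))).
    assert (X2 : ex_derive s t) by (now exists (r * cos (th t) / nu (s t))).
    assert (X3 : ex_derive nu (s t)) by (exists (nu (s t) * p (s t)); now apply Dnu).
    specialize (Pnu (s t)).
    auto_derive; [repeat split; try assumption; lra |].
    replace (Derive (fun x => th x) t) with (dz (s t) / nu (s t))
      by (symmetry; now apply is_derive_unique).
    replace (Derive (fun x => s x) t) with (r * cos (th t) / nu (s t))
      by (symmetry; now apply is_derive_unique).
    replace (Derive (fun x => nu x) (s t)) with (nu (s t) * p (s t))
      by (symmetry; apply is_derive_unique; now apply Dnu).
    replace (Derive s t) with (r * cos (th t) / nu (s t)) by (symmetry; apply Ds').
    specialize (Ez (s t) (near t)); rewrite zs in Ez.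
    replace (q (s t)) with (r * sin (th t) * dz (s t) / nu (s t) ^ 2) by (rewrite Ez; field; lra).
    field; lra. }
  (* The converse inclusion uses that [th] takes every value; the position is then recovered from
     [z] by injectivity. *)
  assert (orbE : forall x, orbit s x <-> E x = r ^ 2).
  { intros [x v]; split.
    - intros [t Ht]; injection Ht; intros -> ->.
      unfold E; simpl fst; simpl snd; rewrite Ds', zs.
      replace (nu (s t) * (r * cos (th t) / nu (s t))) with (r * cos (th t)).
      + apply scirc.
      + specialize (Pnu (s t)); field; lra.
    - unfold E; simpl fst; simpl snd; intros Hx.
      destruct (polar_coordinates _ _ r Hr Hx) as (u & Hu1 & Hu2).
      destruct (thsurj u) as [t Ht]; exists t.
      assert (xs : x = s t) by (apply zinj; now rewrite zs, Ht).
      rewrite Ds', Ht, <- Hu1, <- xs; f_equal.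
      specialize (Pnu x); field; lra. }
  exists s; split; [| split; [| split; [| split; [| split]]]].
  - intros t; destruct (good t) as [H1 H2]; repeat split.
    + exact H1.
    + now exists (r * cos (th t) / nu (s t)).
    + now exists (- (p (s t) * Derive s t ^ 2 + q (s t))).
    + replace (Derive_n s 2 t) with (- (p (s t) * Derive s t ^ 2 + q (s t)))
        by (symmetry; apply is_derive_unique, Dds).
      unfold p, q; field; exact H2.
  - intros t; apply good.
  - assert (N0 := Pnu s0); assert (Ev : nu s0 * v0 / nu s0 = v0) by (field; lra).
    now rewrite Ds', s0E, th0E, <- Hth1, Ev.
  - now exists P.
  - rewrite orbE, Ee; lra.
  (* Below the level [r ^ 2] one has [|x - e| < d] and [|v| < r / nu x <= r * M], where [M] is the
     maximum of [1 / nu] on [[e - d, e + d]]. Balls of the product are squares, so the radius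
     [d + r * M] covers both coordinates. *)
  - destruct (continuity_ab_maj (fun x => / nu x) (e - d) (e + d)) as (xM & HM & _).
    + lra.
    + intros x _; apply continuity_pt_filterlim.
      apply (continuous_Rinv_comp nu); [apply Cnu | specialize (Pnu x); lra].
    + set (M := / nu xM) in *.
      assert (MP : 0 < M) by (apply Rinv_0_lt_compat, Pnu).
      exists (d + r * M); intros w Cw w0 wK.
      assert (Lt : E (w 1) < r ^ 2).
      { destruct (Rlt_le_dec (E (w 1)) (r ^ 2)) as [L | L]; [exact L | exfalso].
        (* The energy along the path starts at 0, so reaching [r ^ 2] would put a point of the path
           on the orbit. *)
        destruct (IVT_gen_consistent (fun t => E (w t)) 0 1 (r ^ 2)) as (t & Ht & Et).
        - intros t; apply (continuous_comp w E); [apply Cw | apply CE].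
        - rewrite w0, Ee; rewrite Rmin_left, Rmax_right; lra.
        - rewrite Rmin_left, Rmax_right in Ht by lra.
          apply (wK t Ht), orbE, Et. }
      destruct (w 1) as [x v]; unfold E in Lt; simpl fst in Lt; simpl snd in Lt.
      assert (H1 := pow2_ge_0 (nu x * v)); assert (H2 := pow2_ge_0 (z x)).
      assert (Hx : Rabs (x - e) < d) by (apply close with (r ^ 2); lra).
      assert (HrM : 0 < r * M) by (now apply Rmult_lt_0_compat).
      split.
      * change (Rabs (x - e) < d + r * M); lra.
      * change (Rabs (v - 0) < d + r * M); rewrite Rminus_0_r.
        assert (Hv : Rabs (nu x * v) < r).
        { rewrite <- (Rabs_pos_eq r) by lra; apply Rsqr_lt_abs_0; rewrite !Rsqr_pow2; lra. }
        specialize (Pnu x); rewrite Rabs_mult, (Rabs_pos_eq (nu x)) in Hv by lra.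
        assert (HMx : / nu x <= M) by (apply HM; apply Rabs_def2 in Hx; lra).
        apply Rlt_trans with (r * M); [| lra].
        replace (Rabs v) with (nu x * Rabs v * / nu x) by (field; lra).
        apply Rlt_le_trans with (r * / nu x).
        -- apply Rmult_lt_compat_r; [now apply Rinv_0_lt_compat | exact Hv].
        -- apply Rmult_le_compat_l; lra.
Qed.

(** The term [p v^2] is quadratic in [v], so the linear part at [(e, 0)] is [(x, v) -> (v, - k x)],
    with eigenvalues [sqrt (- k)] and its opposite. *)
Lemma saddle_of_negative_slope (a b c : R -> R) (e k : R) :
  locally e (fun x => continuous (fun x => b x / a x) x) ->
  c e = 0 -> is_derive (fun x => c x / a x) e k -> k < 0 ->
  saddle a b c e.
Proof.
  intros Cp ce Dq Hk.
  set (p := fun x => b x / a x) in *; set (q := fun x => c x / a x) in *.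
  (* The velocity comes first because total differentiability is obtained from a continuous partial
     derivative in the first variable and a derivative at the point in the second. The field is
     polynomial in [v], while in [x] a derivative is available only at [e]. *)
  set (f := fun v x => - (b x * v ^ 2 + c x) / a x).
  assert (fE : forall v x, f v x = - (p x * v ^ 2 + q x)).
  { intros v x; unfold f, p, q, Rdiv; ring. }
  assert (Df : filterdiff (fun x : R * R => f (snd x) (fst x)) (locally ((e, 0) : R * R))
                 (fun x => plus (scal (snd x) (- (p e * (2 * 0)))) (scal (fst x) (- k)))).
  { apply (filterdiff_comp'_2 (fun x : R * R => snd x) (fun x : R * R => fst x) f (e, 0)
      (fun x => snd x) (fun x => fst x)
      (fun v x => plus (scal v (- (p e * (2 * 0)))) (scal x (- k)))).
    - apply filterdiff_linear, is_linear_snd.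
    - apply filterdiff_linear, is_linear_fst.
    - apply (is_derive_filterdiff f 0 e (fun v x => - (p x * (2 * v)))).
      + apply filter_forall; intros [v x]; simpl.
        apply (is_derive_ext (fun v => - (p x * v ^ 2 + q x))).
        * intros u; now rewrite fE.
        * auto_derive; [easy | ring].
      + apply (is_derive_ext (fun x => - q x)).
        * intros x; rewrite fE; change (- q x = - (p x * 0 ^ 2 + q x)); ring.
        * now apply (is_derive_opp q e k).
      + apply (continuous_opp (fun u : R * R => p (snd u) * (2 * fst u))).
        apply (continuous_mult (fun u : R * R => p (snd u)) (fun u => 2 * fst u)).
        * apply (continuous_comp (fun u : R * R => snd u) p); [apply (continuous_snd (U := R_UniformSpace)) |].
          now apply locally_singleton in Cp.
        * apply (continuous_mult (fun _ : R * R => 2) (fun u => fst u)).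
          -- apply continuous_const.
          -- apply (continuous_fst (V := R_UniformSpace)). }
  set (L := fun x : R * R => (snd x, plus (scal (snd x) (- (p e * (2 * 0)))) (scal (fst x) (- k)))).
  exists L; split.
  - apply (filterdiff_comp'_2 (fun x : R * R => snd x) (fun x : R * R => f (snd x) (fst x))
      (fun u v => (u, v)) (e, 0) (fun x => snd x)
      (fun x => plus (scal (snd x) (- (p e * (2 * 0)))) (scal (fst x) (- k))) (fun u v => (u, v))).
    + apply filterdiff_linear, is_linear_snd.
    + exact Df.
    + apply filterdiff_linear, is_linear_prod; [apply is_linear_fst | apply is_linear_snd].
  - assert (Hl : 0 < sqrt (- k)) by (apply sqrt_lt_R0; lra).
    assert (Hl2 : sqrt (- k) * sqrt (- k) = - k) by (apply sqrt_sqrt; lra).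
    assert (eig : forall l, l * l = - k -> eigenvalue L l).
    { intros l Hll; exists (1, l); split.
      - intros E; injection E; lra.
      - unfold L, plus, scal; simpl; unfold mult; simpl.
        f_equal; [ring | rewrite Hll; ring]. }
    exists (- sqrt (- k)), (sqrt (- k)); split; [lra | split; apply eig; lra].
Qed.

(** * Regularity of the reduced coefficients and conclusion *)

(** In the quotient rule the derivative of [a] is multiplied by [c e = 0]. *)
Lemma is_derive_div_at_zero (c a : R -> R) (e c' : R) :
  c e = 0 -> is_derive c e c' -> ex_derive a e -> a e <> 0 ->
  is_derive (fun x => c x / a x) e (c' / a e).
Proof.
  intros ce Dc Da Na.
  assert (Ec : ex_derive c e) by (now exists c').
  auto_derive; [now split |].
  replace (Derive (fun x => c x) e) with c' by (symmetry; now apply is_derive_unique).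
  rewrite ce; field; exact Na.
Qed.

Lemma continuous_div (f g : R -> R) x :
  ex_derive f x -> ex_derive g x -> g x <> 0 -> continuous (fun x => f x / g x) x.
Proof.
  intros; apply (ex_derive_continuous (fun x => f x / g x)); auto_derive; now split.
Qed.

(** The explicit formula holds on the open set [U], hence on a neighborhood of [x], and may be
    differentiated in place of [alpha]. *)
Lemma ex_derive_alpha (F : ball_on_frame) (Theta : R -> R) (U : R -> Prop) (x : R) :
  open U -> valid_frame F U -> smooth_on U Theta -> U x ->
  ex_derive (alpha F Theta) x.
Proof.
  intros HU HF HT Ux.
  assert (Hz := zeta'_pos F U x HF Ux).
  eapply ex_derive_ext_loc.
  { apply filter_imp with (2 := HU x Ux); intros y Uy.
    symmetry; exact (alpha_explicit F Theta U y HF HT Uy). }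
  destruct HF as (_ & _ & _ & _ & _ & Hs1 & Hs2 & Hzeta & Hpsi & _).
  assert (D1 := Hs1 1%nat x Ux); assert (D2 := Hs2 1%nat x Ux).
  assert (D3 := Hzeta 2%nat x Ux).
  assert (D4 := Hpsi 1%nat x Ux); assert (D5 := Hpsi 2%nat x Ux).
  assert (D6 := HT 2%nat x Ux).
  clear Hs1 Hs2 Hzeta Hpsi HT.
  unfold kappa_vec, kappa, normal, dot; cbn [fst snd].
  set (f1 := fun x => fst (Defs.sigma F x)); change (ex_derive f1 x) in D1.
  set (f2 := fun x => snd (Defs.sigma F x)); change (ex_derive f2 x) in D2.
  change (ex_derive (Derive (zeta F)) x) in D3.
  change (ex_derive (psi F) x) in D4.
  change (ex_derive (Derive (psi F)) x) in D5.
  change (ex_derive (Derive Theta) x) in D6.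
  generalize dependent (Derive (zeta F)); intros f3 Hz D3.
  generalize dependent (Derive (psi F)); intros f5 D5.
  generalize dependent (psi F); intros f4 D4.
  generalize dependent (Derive Theta); intros f6 D6.
  (* Here [sigma = (f1, f2)], [zeta' = f3], [psi = f4], [psi' = f5], [Theta' = f6], and the
     curvature is [f5 / f3]. *)
  apply (ex_derive_ext (fun y =>
    (J_b F / r_b F * (f5 y / f3 y + 1 / r_b F) +
      mass F * (1 + (f1 y * (f5 y / f3 y * - sin (f4 y)) + f2 y * (f5 y / f3 y * cos (f4 y))))) *
      f3 y ^ 2
    - (mass F * (f1 y * - sin (f4 y) + f2 y * cos (f4 y)) + J_b F / r_b F) * f3 y * f6 y)).
  { reflexivity. }
  clearbody f1 f2.
  auto_derive; repeat split; trivial; now apply Rgt_not_eq.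
Qed.

Lemma ex_derive_beta (F : ball_on_frame) (Theta : R -> R) (U : R -> Prop) (x : R) :
  open U -> valid_frame F U -> smooth_on U Theta -> U x ->
  ex_derive (beta F Theta) x.
Proof.
  intros HU HF HT Ux.
  eapply ex_derive_ext_loc.
  { apply filter_imp with (2 := HU x Ux); intros y Uy.
    symmetry; exact (beta_explicit F Theta U y HU HF HT Uy). }
  destruct HF as (_ & _ & _ & _ & _ & Hs1 & Hs2 & Hzeta & Hpsi & _).
  assert (D1 := Hs1 1%nat x Ux); assert (D2 := Hs2 1%nat x Ux).
  assert (D3 := Hzeta 2%nat x Ux); assert (D3' := Hzeta 3%nat x Ux).
  assert (D4 := Hpsi 1%nat x Ux); assert (D5 := Hpsi 2%nat x Ux); assert (D5' := Hpsi 3%nat x Ux).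
  assert (D6 := HT 2%nat x Ux); assert (D6' := HT 3%nat x Ux).
  clear Hs1 Hs2 Hzeta Hpsi HT.
  unfold normal, tangent, dot; cbn [fst snd].
  set (f1 := fun x => fst (Defs.sigma F x)); change (ex_derive f1 x) in D1.
  set (f2 := fun x => snd (Defs.sigma F x)); change (ex_derive f2 x) in D2.
  change (ex_derive (Derive (zeta F)) x) in D3.
  change (ex_derive (Derive_n (zeta F) 2) x) in D3'.
  change (ex_derive (psi F) x) in D4.
  change (ex_derive (Derive (psi F)) x) in D5.
  change (ex_derive (Derive_n (psi F) 2) x) in D5'.
  change (ex_derive (Derive Theta) x) in D6.
  change (ex_derive (Derive_n Theta 2) x) in D6'.
  generalize dependent (Derive_n (zeta F) 2); intros g3 D3'.
  generalize dependent (Derive (zeta F)); intros f3 D3.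
  generalize dependent (Derive_n (psi F) 2); intros g5 D5'.
  generalize dependent (Derive (psi F)); intros f5 D5.
  generalize dependent (psi F); intros f4 D4.
  generalize dependent (Derive Theta); intros f6 D6.
  generalize dependent (Derive_n Theta 2); intros g6 D6'.
  (* As for [alpha], with [g3], [g5], [g6] the second derivatives of [zeta], [psi], [Theta]; this is
     where third derivatives enter. *)
  apply (ex_derive_ext (fun y =>
    - (mass F * (f1 y * - sin (f4 y) + f2 y * cos (f4 y)) + J_b F / r_b F) * f3 y * (g6 y - g5 y)
    - mass F * f3 y * (f1 y * cos (f4 y) + f2 y * sin (f4 y)) * (f6 y - f5 y) ^ 2
    + (J_b F / r_b F ^ 2 + mass F) * f3 y * g3 y)).
  { reflexivity. }
  clearbody f1 f2.
  auto_derive; repeat split; assumption.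
Qed.

Lemma is_derive_gamma (F : ball_on_frame) (Theta : R -> R) (U : R -> Prop) (x : R) :
  valid_frame F U -> smooth_on U Theta -> U x ->
  is_derive (gamma F Theta) x
    (mass F * grav F *
      (Derive_n (zeta F) 2 x * sin (Theta x) + Derive (zeta F) x * (cos (Theta x) * Derive Theta x))).
Proof.
  intros (_ & _ & _ & _ & _ & _ & _ & Hzeta & _) HT Ux.
  change (Derive_n (zeta F) 2 x) with (Derive (Derive (zeta F)) x).
  assert (D1 : ex_derive (Derive (zeta F)) x) by apply (Hzeta 2%nat x Ux).
  assert (D2 : ex_derive Theta x) by apply (HT 1%nat x Ux).
  generalize (gamma_explicit F Theta).
  generalize dependent (Derive (zeta F)); intros z1 D1 E.
  apply (is_derive_ext (fun s => mass F * grav F * z1 s * sin (Theta s))); [now intros s; rewrite E |].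
  auto_derive; [now repeat split |].
  replace (Derive (fun s => z1 s) x) with (Derive z1 x) by reflexivity.
  replace (Derive (fun s => Theta s) x) with (Derive Theta x) by reflexivity.
  ring.
Qed.

Theorem proposition20
  (F : ball_on_frame) (U S : R -> Prop) (Theta : R -> R)
  (U_open : open U)
  (S_sub_U : forall s : R, S s -> U s)
  (F_valid : valid_frame F U)
  (Theta_smooth : smooth_on U Theta)
  (S_circle : circle_domain F Theta S)
  (s_e : R) (s_e_in_S : S s_e)
  (alpha_s_e : alpha F Theta s_e <> 0)
  (Theta_s_e : Theta s_e = 0) :
  equilibrium U (alpha F Theta) (beta F Theta) (gamma F Theta) s_e /\
  (0 < Derive Theta s_e / alpha F Theta s_e ->
     center U (alpha F Theta) (beta F Theta) (gamma F Theta) s_e) /\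
  (Derive Theta s_e / alpha F Theta s_e < 0 ->
     saddle (alpha F Theta) (beta F Theta) (gamma F Theta) s_e).
Proof.
  assert (Ue := S_sub_U s_e s_e_in_S).
  assert (g0 : gamma F Theta s_e = 0) by (rewrite gamma_explicit, Theta_s_e, sin_0; ring).
  assert (Da := fun x => ex_derive_alpha F Theta U x U_open F_valid Theta_smooth).
  assert (Db := fun x => ex_derive_beta F Theta U x U_open F_valid Theta_smooth).
  (* At [s_e] the sine vanishes and the cosine is 1, so [gamma' = M Theta']. As [M > 0], the slope
     of [gamma / alpha] has the sign of [Theta' / alpha]. *)
  set (M := mass F * grav F * Derive (zeta F) s_e).
  assert (MP : 0 < M).
  { assert (Z := zeta'_pos F U s_e F_valid Ue).
    destruct F_valid as (Hm & _ & _ & _ & Hg & _).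
    unfold M; repeat apply Rmult_lt_0_compat; assumption. }
  assert (Dq : is_derive (fun x => gamma F Theta x / alpha F Theta x) s_e
                 (M * (Derive Theta s_e / alpha F Theta s_e))).
  { unfold Rdiv; rewrite <- Rmult_assoc; apply is_derive_div_at_zero; trivial.
    - generalize (is_derive_gamma F Theta U s_e F_valid Theta_smooth Ue).
      now rewrite Theta_s_e, sin_0, cos_0, Rmult_0_r, Rplus_0_l, Rmult_1_l, <- Rmult_assoc.
    - now apply Da. }
  assert (Loc : locally s_e (fun x => U x /\ alpha F Theta x <> 0)).
  { apply filter_and; [now apply U_open |].
    apply (ex_derive_continuous (alpha F Theta) s_e (Da s_e Ue) (fun y => y <> 0)).
    exists (mkposreal _ (Rabs_pos_lt _ alpha_s_e)); intros y Hy ->.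
    change (Rabs (0 - alpha F Theta s_e) < Rabs (alpha F Theta s_e)) in Hy.
    rewrite Rminus_0_l, Rabs_Ropp in Hy; lra. }
  split; [| split].
  - split; [exact alpha_s_e |].
    intros t.
    assert (D1 : forall u, Derive (fun _ : R => s_e) u = 0) by (intros u; apply Derive_const).
    assert (D2 : is_derive (Derive (fun _ : R => s_e)) t 0).
    { apply (is_derive_ext (fun _ => 0)); [now intros u; rewrite D1 | apply (is_derive_const 0)]. }
    repeat split.
    + exact Ue.
    + apply ex_derive_const.
    + now exists 0.
    + replace (Derive_n (fun _ : R => s_e) 2 t) with 0 by (symmetry; now apply is_derive_unique).
      rewrite D1, g0; ring.
  - intros Hpos; apply center_of_positive_slope with (3 := Dq); [| exact g0 |].
    + apply filter_imp with (2 := Loc); intros x [Ux ax].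
      refine (conj Ux (conj ax (conj _ _))); apply continuous_div; auto.
      eexists; now apply is_derive_gamma with U.
    + now apply Rmult_lt_0_compat.
  - intros Hneg; apply saddle_of_negative_slope with (3 := Dq); [| exact g0 |].
    + apply filter_imp with (2 := Loc); intros x [Ux ax]; apply continuous_div; auto.
    + rewrite <- (Rmult_0_r M); now apply Rmult_lt_compat_l.
Qed.
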